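(* Let $\kappa$ be a regular uncountable cardinal and $X$ a set of ordinals with $\kappa\subseteq X$. For every ordinal $\xi<\kappa$ the following hold. (1) For every $A\subseteq P_\kappa X$, \[d_\xi(A)=\{x\in P_\kappa X\mid A \text{ is } \xi\text{-s-strongly stationary in } P_{\kappa_x}x\}.\] (2) For every $x\in P_\kappa X$ and $A\subseteq P_\kappa X$: $A$ is $(\xi+1)$-s-strongly stationary in $P_{\kappa_x}x$ if and only if for every $\zeta\leq\xi$ and every pair $S,T$ of subsets of $P_{\kappa_x}x$ which are $\zeta$-s-strongly stationary in $P_{\kappa_x}x$, we have $A\cap d_\zeta(S)\cap d_\zeta(T)\cap P_{\kappa_x}x\neq\emptyset$ (equivalently, $A\cap d_\zeta(S)\cap d_\zeta(T)$ is $\zeta$-s-strongly stationary in $P_{\kappa_x}x$). (3) For every $x\in P_\kappa X$: if $A\subseteq P_\kappa X$ is $\xi$-s-strongly stationary in $P_{\kappa_x}x$, $n<\omega$, and for each $i<n$ the set $A_i\subseteq P_\kappa X$ is $\zeta_i$-s-strongly stationary in $P_{\kappa_x}x$ for some $\zeta_i<\xi$, then $A\cap d_{\zeta_0}(A_0)\cap\cdots\cap d_{\zeta_{n-1}}(A_{n-1})$ is $\xi$-s-strongly stationary in $P_{\kappa_x}x$.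
   Context: $P_\kappa X=\{x\subseteq X\mid |x|<\kappa\}$. For $x\in P_\kappa X$, $\kappa_x:=|x\cap\kappa|$ and $P_{\kappa_x}x:=\{y\subseteq x\mid |y|<\kappa_x\}$. For $x,y\in P_\kappa X$, $x\prec y$ means $x\subseteq y$ and $|x|<\kappa_y$ (so $y\in P_{\kappa_x}x$ iff $y\prec x$). A set $A\subseteq P_\kappa X$ is $\prec$-cofinal in $P_{\kappa_x}x$ if for every $y\in P_{\kappa_x}x$ there is $z\in A$ with $y\prec z\prec x$. Derived topologies: for $x\prec y$ let $(x,y]=\{z\in P_\kappa X\mid x\prec z\prec y \text{ or } z=y\}$. Let $\tau_0$ be the topology on $P_\kappa X$ generated by $\mathcal B_0=\{\{\emptyset\}\}\cup\{(x,y]\mid x,y\in P_\kappa X,\ x\prec y\}$. Given $\tau_\xi$ and $\mathcal B_\xi$, let $d_\xi(A)$ be the set of limit points of $A$ in $(P_\kappa X,\tau_\xi)$; let $\mathcal B_{\xi+1}=\mathcal B_\xi\cup\{d_\xi(A)\mid A\subseteq P_\kappa X\}$ and $\tau_{\xi+1}$ the topology generated by $\mathcal B_{\xi+1}$; for limit $\xi$, $\mathcal B_\xi=\bigcup_{\zeta<\xi}\mathcal B_\zeta$ and $\tau_\xi$ is the topology generated by $\mathcal B_\xi$. $\xi$-s-strong stationarity (defined by recursion on the ordinal $\xi$, for $A\subseteq P_\kappa X$ and $x\in P_\kappa X$): $A$ is $0$-s-strongly stationary in $P_{\kappa_x}x$ iff $A$ is $\prec$-cofinal in $P_{\kappa_x}x$.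 For $\xi>0$, $A$ is $\xi$-s-strongly stationary in $P_{\kappa_x}x$ iff $\kappa_x$ is a limit cardinal and, whenever $\zeta<\xi$ and $S,T\subseteq P_\kappa X$ are both $\zeta$-s-strongly stationary in $P_{\kappa_x}x$, there is $y\in A\cap P_{\kappa_x}x$ such that $S$ and $T$ are both $\zeta$-s-strongly stationary in $P_{\kappa_y}y$.
   Formalization: Cofinality in P_{κ_x}x also requires x∩κ≠∅; B_0 contains {x} for every x with x∩κ=∅, not only {∅}; and in (2) the right-hand side of the first equivalence also states that κ_x is a limit cardinal. *)

(* Defs.v *)
From HB Require Import structures.
From mathcomp Require Import all_boot all_order.
From mathcomp Require Import boolp classical_sets functions cardinality topology.

Set Implicit Arguments.
Unset Strict Implicit.
Unset Printing Implicit Defensive.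

Import Order.TTheory.
Local Open Scope classical_set_scope.
Local Open Scope card_scope.
Local Open Scope order_scope.

(** * Ordinals

  Ordinals are the elements of a well-ordered type [O].  Every set of ordinals
  is contained in an ordinal, and every well-ordered type is isomorphic to an
  ordinal, so quantifying over all [O : wellOrderType d], all [k : O] and all
  [X : set O] is quantifying over all ordinals k and all sets X of ordinals. *)

HB.mixin Record isWellOrder d (T : Type) of Order.Total d T := {
  lt_wf : well_founded (fun a b : T => a < b)
}.

#[short(type="wellOrderType")]
HB.structure Definition WellOrder d := {T of isWellOrder d T & Order.Total d T}.

Section Ordinals.
Context {d : Order.disp_t} {O : wellOrderType d}.
Implicit Types (a b c k : O).

(** The von Neumann ordinal [k] as a set of ordinals. *)
Definition below k : set O := [set a | a < k].

Definition is_zero a := forall b, a <= b.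

Definition is_succ a b := a < b /\ forall c, a < c -> b <= c.

Definition is_limit a := ~ is_zero a /\ ~ exists b, is_succ b a.

(** The junk value [a] is only taken when [a] is the maximum of [O]. *)
Definition osucc a : O := xget a [set b | is_succ a b].

End Ordinals.

(** * Cardinals

  [card_lt A B] is |A| < |B|. A cardinal is given by any set of that size. *)
Definition card_lt {T U : Type} (A : set T) (B : set U) : Prop :=
  ~ (B #<= A).

(** The cardinal |A| is a limit cardinal, i.e., neither zero nor a successor;
  the cardinals at most |A| are those of the subsets of the same type.  Note
  that aleph_0 counts as a limit cardinal. *)
Definition limit_cardinal {T : Type} (A : set T) : Prop :=
  A !=set0 /\
  forall B : set T, card_lt B A -> exists C : set T, card_lt B C /\ card_lt C A.

Section RegularCardinals.
Context {d : Order.disp_t} {O : wellOrderType d}.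
Implicit Types k : O.

Definition is_cardinal k : Prop :=
  forall a, a < k -> card_lt (below a) (below k).

Definition regular_uncountable k : Prop :=
  [/\ is_cardinal k,
      ~ countable (below k) &
      forall A : set O, A `<=` below k ->
        (forall a, a < k -> exists2 b, A b & a <= b) ->
        below k #<= A].

End RegularCardinals.

(** * P_k X and the relation ≺ *)

Section PkX.
Context {d : Order.disp_t} {O : wellOrderType d}.
Variables (k : O) (X : set O).

Definition PkX : set (set O) := [set x | x `<=` X /\ card_lt x (below k)].

Implicit Types (x y z : PkX) (A S T : set PkX).

(** x ∩ k, a set of cardinality k_x. *)
Definition trace x : set O := val x `&` below k.

Definition prec x y : Prop := val x `<=` val y /\ card_lt (val x) (trace y).

(** P_{k_x} x as a set of points of P_k X: since k_x <= |x| < k, a set y ⊆ x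
  with |y| < k_x is automatically in P_k X. *)
Definition Pkx x : set PkX := [set y | prec y x].

Lemma Pkx_eq0 x : Pkx x = set0 <-> trace x = set0.
Proof.
split=> [Px0 | tx0]; last first.
  by apply/seteqP; split=> // y [_]; rewrite /card_lt tx0 card_ge0.
have e0 : PkX set0.
  split=> // k0; case: (set_mem (valP x)) => _; apply.
  by move/card_le0P: k0 => ->; exact: card_ge0.
apply: contrapT => tx.
suff : Pkx x (SigSub (mem_set e0)) by rewrite Px0.
by split=> //= /card_le0P.
Qed.

(** Cofinal subsets are only considered when P_{k_x} x is nonempty, that is,
  when x ∩ k is nonempty (Pkx_eq0).  If x ∩ k = ∅, then P_{k_x} x = ∅ and every
  A, even A = ∅, would vacuously be cofinal although x is not a limit point. *)
Definition prec_cofinal A x : Prop :=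
  Pkx x !=set0 /\
  forall y, Pkx x y -> exists z, [/\ A z, prec y z & prec z x].

(** * Derived topologies *)

Definition prec_itv x y : set PkX := [set z | (prec x z /\ prec z y) \/ z = y].

(** The singletons of the ≺-minimal points, which belong to no (x, y], and the
  intervals (x, y].  By Pkx_eq0 the ≺-minimal points are those disjoint from k:
  ∅, and, when X strictly contains k, also the nonempty x ⊆ X \ k, which would
  otherwise have the whole space as their only neighbourhood. *)
Definition base0 : set (set PkX) :=
  [set [set x] | x in [set x | Pkx x = set0]] `|`
  [set U | exists x y, prec x y /\ U = prec_itv x y].

(** P_k X with the topology generated by (i.e., having as a subbase) [B]. *)
Definition generated (B : set (set PkX)) : Type := PkX.
HB.instance Definition _ (B : set (set PkX)) := Choice.on (generated B).
HB.instance Definition _ (B : set (set PkX)) :=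
  isSubBaseTopological.Build (generated B) B id.

Lemma nbhs_generated (B : set (set PkX)) x (U : set PkX) :
  @nbhs PkX (generated B) x U <->
  exists V, [/\ finI_from B id V, V x & V `<=` U].
Proof.
split=> [[W [[D sD <-]]] [V DV Vx] WU | [V [fV Vx VU]]].
  by exists V; split => // [|z Vz]; [exact: sD | apply: WU; exists V].
exists V => //; split => //.
by exists [set V]; [move=> W -> | rewrite bigcup_set1].
Qed.

(** The limit points of [A] in the topology generated by [B]. *)
Definition derived_of (B : set (set PkX)) (A : set PkX) : set PkX :=
  @limit_point (generated B) A.

(** The three clauses are the cases "xi = 0", "xi is a successor" and "xi is a
  limit" of the recursion; exactly one of them applies to a given xi. *)
Definition base_step (xi : O)
    (rec : forall zeta, zeta < xi -> set (set PkX)) : set (set PkX) :=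
  [set U | [\/ is_zero xi /\ base0 U,
      exists zeta (h : zeta < xi), is_succ zeta xi /\
        (rec zeta h U \/ exists A, U = derived_of (rec zeta h) A) |
      is_limit xi /\ exists zeta (h : zeta < xi), rec zeta h U]].

Definition base : O -> set (set PkX) :=
  Fix lt_wf (fun _ => set (set PkX)) base_step.

Lemma baseE xi : base xi = base_step (fun zeta (_ : zeta < xi) => base zeta).
Proof.
apply: (Fix_eq _ (fun _ => set (set PkX))) => a f g fg.
congr base_step.
by apply: functional_extensionality_dep => b; apply/funext => h; exact: fg.
Qed.

Definition derived (xi : O) (A : set PkX) : set PkX := derived_of (base xi) A.

(** * xi-s-strong stationarity *)

Definition sss_step (xi : O)
    (rec : forall zeta, zeta < xi -> set PkX -> PkX -> Prop)
    (A : set PkX) (x : PkX) : Prop :=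
  (is_zero xi /\ prec_cofinal A x) \/
  (~ is_zero xi /\ limit_cardinal (trace x) /\
   forall zeta (h : zeta < xi) S T, rec zeta h S x -> rec zeta h T x ->
     exists y, [/\ A y, Pkx x y, rec zeta h S y & rec zeta h T y]).

(** [sss xi A x]: A is xi-s-strongly stationary in P_{k_x} x. *)
Definition sss : O -> set PkX -> PkX -> Prop :=
  Fix lt_wf (fun _ => set PkX -> PkX -> Prop) sss_step.

Lemma sssE xi : sss xi = sss_step (fun zeta (_ : zeta < xi) => sss zeta).
Proof.
apply: (Fix_eq _ (fun _ => set PkX -> PkX -> Prop)) => a f g fg.
congr sss_step.
by apply: functional_extensionality_dep => b; apply/funext => h; exact: fg.
Qed.

End PkX.

Arguments sss {d O k X} xi A x.
Arguments derived {d O k X} xi A.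
Arguments Pkx {d O k X} x.
Arguments trace {d O k X} x.

(* Main.v *)
Require Import Defs.
From mathcomp Require Import all_boot all_order finmap.
From mathcomp Require Import boolp classical_sets functions cardinality topology.

(** The heart of the matter is (3): intersecting a xi-s-strongly stationary set A
  with the set of points where a zeta-s-strongly stationary set B reflects,
  zeta < xi, keeps A xi-s-strongly stationary.  This goes by induction on xi,
  using that s-strong stationarity passes to lower levels and that the sets
  [sss zeta B] are closed ([sss_sss]): to reflect B together with S and T of
  level eta < xi, intersect first the sets of the higher level with the points
  where those of the lower level reflect.  If eta = zeta, then
  [sss zeta S `&` sss zeta T] is itself zeta-s-strongly stationary, and reflects
  together with B.  Given (3), the sets U such that intersecting with U preserves
  xi-s-strong stationarity at x form a filter which contains the subbasic open
  sets around x, whence (1); and (2) follows. *)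

Set Implicit Arguments.
Unset Strict Implicit.
Unset Printing Implicit Defensive.

Import Order.TTheory.
Local Open Scope classical_set_scope.
Local Open Scope card_scope.
Local Open Scope order_scope.

(** * Cardinals *)

(** Choice picks a related point for each element. Working with relations lets graphs produced by
    Zorn's lemma be used directly. *)
Lemma graph_card_le (T U : Type) (A : set T) (B : set U) (R : T -> U -> Prop) :
    (forall a, A a -> exists2 b, B b & R a b) ->
    (forall a a' b, A a -> A a' -> R a b -> R a' b -> a = a') ->
  A #<= B.
Proof.
elim/Ppointed: U => U in B R *.
  move=> AB _; suff -> : A = set0 by [].
  by rewrite -subset0 => a /AB[b]; rewrite emptyE.
move=> AB Rinj; apply/pcard_leP/injfunPex.
have /choice[f fP] a : exists b, A a -> B b /\ R a b.
  by have [/AB[b]|] := pselect (A a); [exists b | exists point].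
exists f => [a /fP[]//|a a' /set_mem Aa /set_mem Aa' e].
have [_ Ra] := fP a Aa; have [_] := fP a' Aa'.
by rewrite -e; apply: (Rinj _ _ _ Aa Aa' Ra).
Qed.

(** Zorn's lemma gives a maximal partial injection; if it missed both a point of [A] and a point of
    [B], adding that pair would enlarge it. *)
Lemma card_le_total (T U : Type) (A : set T) (B : set U) : A #<= B \/ B #<= A.
Proof.
pose P : set (set (T * U)) := [set G | G `<=` A `*` B /\
  forall p q, G p -> G q -> p.1 = q.1 <-> p.2 = q.2].
have [F FP Ftot|G [[GAB Ginj] Gmax]] := @Zorn_bigcup _ P.
  split=> [p [G /FP[GAB _] /GAB//]|p q [G FG Gp] [H FH Hq]].
  have [GH|HG] := Ftot _ _ FG FH.
    by apply: (FP _ FH).2 => //; exact: GH.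
  by apply: (FP _ FG).2 => //; exact: HG.
have [AG|/existsNP[a /not_implyP[Aa nGa]]] :=
    pselect (forall a, A a -> exists b, G (a, b)).
  left; apply: (@graph_card_le _ _ _ _ (fun a b => G (a, b))) => [a /AG[b Gab]|].
    by exists b => //; have [] := GAB _ Gab.
  by move=> a a' b _ _ /Ginj Gab /Gab[_]; apply.
right; apply: (@graph_card_le _ _ _ _ (fun b a => G (a, b))) => [b Bb|]; last first.
  by move=> b b' c _ _ /Ginj Gab /Gab[+ _]; apply.
apply: contrapT => nGb; have {}nGb a' : ~ G (a', b).
  by move=> Gab; apply: nGb; exists a' => //; have [] := GAB _ Gab.
apply: (Gmax (G `|` [set (a, b)])); first split.
- by move=> p; left.
- by move/(_ (a, b) (or_intror erefl)); exact: nGb.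
split=> [p [/GAB//|-> //]|[a1 b1] [a2 b2] [G1|[-> ->]] [G2|[-> ->]]//=].
- exact: (Ginj _ _ G1 G2).
- by split=> e; rewrite e in G1; [case: nGa; exists b1 | case: (nGb a1)].
- by split=> e; rewrite -e in G2; [case: nGa; exists b2 | case: (nGb a2)].
Qed.

Lemma card_setU_le_setX (T : Type) (A B : set T) :
  A #<= B -> A `|` B #<= B `*` [set: bool].
Proof.
elim/Ppointed: T => T in A B *; first by rewrite !emptyE.
move=> /pcard_leP/injfunPex[f fAB finj].
apply: (@graph_card_le _ _ _ _
  (fun t p => p = (t, true) \/ A t /\ p = (f t, false))).
  move=> t [At|Bt]; last by exists (t, true) => //; left.
  by exists (f t, false); [split=> //; exact: fAB | right].
move=> t t' p _ _ [->|[At ->]] [[]//|[At' [e]]]//.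
by apply: finj => //; rewrite inE.
Qed.

Lemma card_le_infinite (T U : Type) (A : set T) (B : set U) :
  finite_set A -> infinite_set B -> A #<= B.
Proof.
by move=> Af Bi; have [//|/card_le_finite/(_ Af)] := card_le_total A B.
Qed.

(* Zorn's lemma gives a maximal injection D * bool -> D with D included in B;
  then B \ D is finite, as D could otherwise be extended by a copy of nat. *)
Lemma card_setX_bool (T : Type) (B : set T) :
  infinite_set B -> B `*` [set: bool] #<= B.
Proof.
move=> Binf; have [t0 _] := infinite_setN0 Binf.
pose dom (G : set ((T * bool) * T)) a := exists b t, G ((a, b), t).
pose P : set (set ((T * bool) * T)) := [set G |
  [/\ forall p, G p -> B p.1.1 /\ dom G p.2,
      forall a b, dom G a -> exists t, G ((a, b), t) &
      forall p q, G p -> G q -> p.1 = q.1 <-> p.2 = q.2]].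
have [F FP Ftot|G [[Gsub Gtot Ginj] Gmax]] := @Zorn_bigcup _ P.
  split=> [p [G FG Gp]|a b [b' [t [G FG Gp]]]|p q [G FG Gp] [H FH Hq]].
  - have [Gsub _ _] := FP _ FG; have [Bp [b [t Gt]]] := Gsub _ Gp.
    by split=> //; exists b, t, G.
  - have [_ Gtot _] := FP _ FG.
    by have [|t' Gt'] := Gtot a b; [exists b', t | exists t', G].
  - have [GH|HG] := Ftot _ _ FG FH.
      by have [_ _] := FP _ FH; apply=> //; exact: GH.
    by have [_ _] := FP _ FG; apply=> //; exact: HG.
have domB : dom G `<=` B by move=> a [b [t /Gsub[]]].
have Gle : dom G `*` [set: bool] #<= dom G.
  apply: (@graph_card_le _ _ _ _ (fun p t => G (p, t))) => [[a b] [/(Gtot _ b)]|].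
    by move=> [t Gt] _; exists t => //; have [] := Gsub _ Gt.
  by move=> p p' t _ _ /Ginj Gp /Gp[_]; apply.
have Rfin : finite_set (B `\` dom G).
  apply: contrapT => /infiniteP.
  elim/Ppointed: T => T in B t0 dom P G Binf Gsub Gtot Ginj Gmax domB Gle *.
    by have := no t0.
  move=> /pcard_leP/injfunPex[h hR hinj'].
  have {hinj'} hinj i j : h i = h j -> i = j by apply: hinj'; rewrite inE.
  have {}hR i : B (h i) /\ ~ dom G (h i) by apply: hR.
  (* The copy [h] of the natural numbers is split by parity: [(h n, b)] goes to index 2n + b, so the
     parity of the index recovers [b]. *)
  pose N : set ((T * bool) * T) :=
    [set p : (T * bool) * T | exists n, p.1.1 = h n /\ p.2 = h (p.1.2 + n.*2)%N].
  have domN n : dom N (h n) by exists true, (h (true + n.*2)%N), n.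
  have domU a : dom (G `|` N) a <-> dom G a \/ dom N a.
    split=> [[b [t [Gt|Nt]]]|[[b [t Gt]]|[b [t Nt]]]].
    - by left; exists b, t.
    - by right; exists b, t.
    - by exists b, t; left.
    - by exists b, t; right.
  apply: (Gmax (G `|` N)); first split.
  - by move=> p; left.
  - move=> NG; have [b [t /or_intror/NG Nt]] := domN 0%N.
    by apply: (hR 0%N).2; exists b, t.
  split.
  - move=> p [/Gsub[Bp dp]|[n [-> ->]]].
      by split=> //; apply/domU; left.
    by split; [have [] := hR n | apply/domU; right].
  - move=> a b /domU[/(Gtot _ b)[t Gt]|[b' [t [n [/= -> _]]]]].
      by exists t; left.
    by exists (h (b + n.*2)%N); right; exists n.
  - have GN (p q : (T * bool) * T) : G p -> N q -> p.1 = q.1 <-> p.2 = q.2.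
      move: p q => [[a b] t] [[a' b'] t'] Gp [n /= [-> ->]].
      split=> [[e _]|e].
        by case: (hR n).2; rewrite -e; exists b, t.
      by case: (hR (b' + n.*2)%N).2; rewrite -e; have [] := Gsub _ Gp.
    move=> p q [Gp|Np] [Gq|Nq]; [exact: Ginj|exact: GN| |].
      by have := GN _ _ Gq Np; split=> /esym/H.
    move: p q Np Nq => [[a b] t] [[a' b'] t'] [n /= [-> ->]] [m /= [-> ->]].
    split=> [[/hinj -> ->]//|/hinj e].
    have eb : b = b' by move/(congr1 odd): e; rewrite !oddD !odd_double !addbF !oddb.
    rewrite eb in e *.
    by move/addnI/double_inj : e => ->.
have Dinf : infinite_set (dom G).
  move=> Dfin; apply: Binf; rewrite -(setDUK domB).
  by rewrite finite_setU.
(* [B] is [dom G] plus a finite remainder, so it embeds in two copies of [dom G], hence in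
   [dom G]. *)
have BD : B #<= dom G.
  rewrite -(setDUK domB) setUC; apply: card_le_trans Gle.
  exact/card_setU_le_setX/card_le_infinite.
apply: card_le_trans (card_le_trans Gle (subset_card_le domB)).
elim/Ppointed: T => T in
  B t0 dom P G Binf Gsub Gtot Ginj Gmax domB Gle Rfin Dinf BD *.
  by have := no t0.
have /pcard_leP/injfunPex[f fBD finj] := BD.
apply: (@graph_card_le _ _ _ _ (fun p q => q = (f p.1, p.2))).
  by move=> [a b] [/= Ba _]; exists (f a, b) => //; split=> //; exact: fBD.
move=> [a b] [a' b'] _ [/= Ba _] [/= Ba' _] -> [e ->].
by rewrite (finj a a') ?inE.
Qed.

(** Let [B] be the larger set. If it is infinite, the union embeds in two copies of [B], hence in
    [B]; if it is finite, so is the union. *)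
Lemma card_setU_lt (T U : Type) (A B : set T) (C : set U) :
  infinite_set C -> card_lt A C -> card_lt B C -> card_lt (A `|` B) C.
Proof.
wlog AB : A B / A #<= B => [hwlog Cinf AC BC|Cinf _ BC CAB].
  have [AB|BA] := card_le_total A B; first exact: hwlog.
  by rewrite setUC; exact: hwlog.
have [Bfin|Binf] := pselect (finite_set B).
  apply/Cinf/(card_le_finite CAB); rewrite finite_setU.
  by split=> //; exact: card_le_finite AB Bfin.
apply: BC; apply: card_le_trans CAB _.
exact: card_le_trans (card_setU_le_setX AB) (card_setX_bool Binf).
Qed.

Lemma card_le_lt_trans (T U V : Type) (A : set T) (B : set U) (C : set V) :
  A #<= B -> card_lt B C -> card_lt A C.
Proof. by move=> AB BC CA; apply: BC; exact: card_le_trans CA AB. Qed.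

Lemma card_lt_le_trans (T U V : Type) (A : set T) (B : set U) (C : set V) :
  card_lt A B -> B #<= C -> card_lt A C.
Proof. by move=> AB BC CA; apply: AB; exact: card_le_trans BC CA. Qed.

Lemma card_ltW (T U : Type) (A : set T) (B : set U) : card_lt A B -> A #<= B.
Proof. by have [|BA /(_ BA)] := card_le_total A B. Qed.

(** No cardinal lies strictly between n and n + 1, so in a finite nonempty [A] removing one point
    refutes the limit property. *)
Lemma limit_cardinal_infinite (T : Type) (A : set T) :
  limit_cardinal A -> infinite_set A.
Proof.
move=> [[a Aa] lim] [n /[dup]/card_eqPle[An nA]]; case: n => [|n] in An nA *.
  by move: An; rewrite II0 => /card_le0P A0; rewrite A0 in Aa.
move=> /eq_cardSP[b Ab /card_eqPle[An' nA']].
have [|C [BC CA]] := lim (A `\ b).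
  move=> AAb; have := card_le_trans nA (card_le_trans AAb An').
  by rewrite card_le_II ltnn.
have [m /card_eqPle[Cm mC]] : finite_set C.
  by apply: card_le_finite (card_ltW CA) _; apply/finite_set_leP; exists n.+1.
have mn : ~~ (n.+1 <= m)%N.
  rewrite -card_le_II; apply/negP => nm; apply: CA.
  exact: card_le_trans An (card_le_trans nm mC).
have nm : ~~ (m <= n)%N.
  rewrite -card_le_II; apply/negP => mn'; apply: BC.
  exact: card_le_trans Cm (card_le_trans mn' nA').
by move: mn nm; rewrite -!ltnNge !ltnS => /leq_ltn_trans h /h; rewrite ltnn.
Qed.

(** * Ordinals and the relation ≺ *)

Section WellOrders.
Context {d : Order.disp_t} {O : wellOrderType d}.
Implicit Types a b : O.

Lemma not_is_zeroP a : ~ is_zero a <-> exists b, b < a.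
Proof.
split=> [/existsNP[b /negP]|[b ba] /(_ b)]; first by rewrite -ltNge; exists b.
by rewrite leNgt ba.
Qed.

Lemma exists_zero a : exists2 b, is_zero b & b <= a.
Proof.
elim/(well_founded_ind (@lt_wf d O)): a => a IH.
have [az|/not_is_zeroP[b ba]] := pselect (is_zero a); first by exists a.
by have [c cz cb] := IH b ba; exists c => //; exact: le_trans cb (ltW ba).
Qed.

(** The bound [b] keeps [osucc] off its junk value: descending from [b] reaches a least element
    above [a]. *)
Lemma osuccP a b : a < b -> is_succ a (osucc a).
Proof.
move=> ab; suff [c ac] : exists c, is_succ a c.
  by rewrite /osucc; case: xgetP => [_ -> //|/(_ c)].
elim/(well_founded_ind (@lt_wf d O)): b ab => b IH ab.
have [[c ac cb]|nc] := pselect (exists2 c, a < c & c < b); first exact: IH ac.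
exists b; split=> // c ac; rewrite leNgt; apply/negP => cb.
by apply: nc; exists c.
Qed.

Lemma lt_succE a b : is_succ a b -> forall c, (c < b) = (c <= a).
Proof.
move=> [ab abP] c; apply/idP/idP => [cb|/le_lt_trans]; last exact.
by rewrite leNgt; apply/negP => /abP; rewrite leNgt cb.
Qed.

End WellOrders.

Section Prec.
Context {d : Order.disp_t} {O : wellOrderType d} {k : O} {X : set O}.
Implicit Types x y z u v : PkX k X.

Lemma sub_PkX x (y : set O) : y `<=` val x -> PkX k X y.
Proof.
have [xX xk] := set_mem (valP x).
move=> yx; split; first exact: subset_trans yx xX.
exact: card_le_lt_trans (subset_card_le yx) xk.
Qed.

Lemma trace_card_le x : trace x #<= val x.
Proof. by apply: subset_card_le => t []. Qed.

Lemma sub_prec x y z : val x `<=` val y -> prec y z -> prec x z.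
Proof.
move=> xy [yz cyz]; split; first exact: subset_trans xy yz.
exact: card_le_lt_trans (subset_card_le xy) cyz.
Qed.

Lemma prec_trans y x z : prec x y -> prec y z -> prec x z.
Proof. by case=> + _; exact: sub_prec. Qed.

Lemma prec_irr x : ~ prec x x.
Proof. by case=> _; apply; exact: trace_card_le. Qed.

(** Take z to be u ∪ v ∪ D with D ⊆ x ∩ κ and |D| strictly between |u ∪ v| and κ_x. Then D makes κ_z
    exceed |u ∪ v|, while |z| stays below the infinite κ_x. *)
Lemma prec_directed x u v : limit_cardinal (trace x) -> prec u x -> prec v x ->
  exists z, [/\ prec u z, prec v z & prec z x].
Proof.
move=> xlim [ux cux] [vx cvx].
have xinf := limit_cardinal_infinite xlim.
have [C [uvC Cx]] := xlim.2 _ (card_setU_lt xinf cux cvx).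
have /card_subP[D /card_eqPle[DC CD] Dx] := card_ltW Cx.
have zx : (val u `|` val v) `|` D `<=` val x.
  by rewrite !subUset; split=> // t /Dx[].
pose z : PkX k X := SigSub (mem_set (sub_PkX zx)).
have uvz : card_lt (val u `|` val v) (trace z).
  apply: card_lt_le_trans uvC (card_le_trans CD (subset_card_le _)) => t Dt.
  by split; [right | case: (Dx _ Dt)].
exists z; split; split=> //.
- by move=> t ut; left; left.
- exact: card_le_lt_trans (subset_card_le (@subsetUl _ _ _)) uvz.
- by move=> t ut; left; right.
- exact: card_le_lt_trans (subset_card_le (@subsetUr _ _ _)) uvz.
- apply: card_setU_lt => //; first exact: card_setU_lt.
  exact: card_le_lt_trans DC Cx.
Qed.

(** A smaller set is copied as some D ⊆ x; a point z with D ≺ z ≺ x gives |D| < κ_z ≤ |z| < κ_x, so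
    κ_z is the intermediate cardinal. *)
Lemma prec_cofinal_limit A x : prec_cofinal A x -> limit_cardinal (trace x).
Proof.
move=> [/set0P/eqP x0 Acof]; split; first by apply/set0P/eqP => /Pkx_eq0.
move=> B Bx; have /card_subP[D /card_eqPle[DB BD] Dx] := card_ltW Bx.
have Dx' : D `<=` val x by move=> t /Dx[].
have [|z [_ [_ Dz] [_ zx]]] := Acof (SigSub (mem_set (sub_PkX Dx'))).
  by split=> //; exact: card_le_lt_trans DB Bx.
exists (trace z); split; first exact: card_le_lt_trans BD Dz.
exact: card_le_lt_trans (trace_card_le z) zx.
Qed.

End Prec.

(** * s-strong stationarity *)

Section Sss.
Context {d : Order.disp_t} {O : wellOrderType d} {k : O} {X : set O}.
Implicit Types (x y z u v : PkX k X) (A B S T : set (PkX k X)).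
Implicit Types xi zeta : O.

Lemma sss_zero xi A x : is_zero xi -> sss xi A x <-> prec_cofinal A x.
Proof. by move=> xi0; rewrite sssE; split=> [[[]|[]]|] //; left. Qed.

Lemma sss_pos xi A x : ~ is_zero xi -> sss xi A x <->
  limit_cardinal (trace x) /\ forall zeta, zeta < xi -> forall S T,
    sss zeta S x -> sss zeta T x ->
    exists y, [/\ A y, prec y x, sss zeta S y & sss zeta T y].
Proof.
by move=> xi0; rewrite sssE; split=> [[[]|[_]]|xA] //; right; split.
Qed.

Lemma sss_limit xi A x : sss xi A x -> limit_cardinal (trace x).
Proof.
have [xi0|xi0] := pselect (is_zero xi).
  by move=> /(sss_zero _ _ xi0); exact: prec_cofinal_limit.
by move=> /(sss_pos _ _ xi0)[].
Qed.

Lemma limit_Pkx0 x : limit_cardinal (trace x) -> Pkx x !=set0.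
Proof. by move=> [/set0P/eqP x0 _]; apply/set0P/eqP => /Pkx_eq0. Qed.

Lemma sss_cofinal xi A x : sss xi A x -> prec_cofinal A x.
Proof.
have [xi0|xi0] := pselect (is_zero xi); first by move=> /(sss_zero _ _ xi0).
move=> /(sss_pos _ _ xi0)[xlim xA]; split; first exact: limit_Pkx0.
move=> u ux; have [b b0 bxi] := exists_zero xi.
have {}bxi : b < xi.
  by rewrite lt_neqAle bxi andbT; apply: contra_notN xi0 => /eqP <-.
(* The cone above [u] is stationary at level zero because ≺ is directed below [x]. Any [y] to which
   it reflects has a [z] with u ≺ z ≺ y. *)
have uS : sss b [set z | prec u z] x.
  apply/sss_zero => //; split; first exact: limit_Pkx0.
  by move=> v vx; have [z [uz vz zx]] := prec_directed xlim ux vx; exists z.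
have [y [Ay yx /(sss_zero _ _ b0)[[w wy] yS] _]] := xA b bxi _ _ uS uS.
have [z [uz _ zy]] := yS w wy.
by exists y; split => //; exact: prec_trans uz zy.
Qed.

Lemma sss_sub xi A B x : (forall y, prec y x -> A y -> B y) ->
  sss xi A x -> sss xi B x.
Proof.
move=> AB; have [xi0|xi0] := pselect (is_zero xi).
  move=> /(sss_zero _ _ xi0)[x0 xA]; apply/sss_zero => //; split=> // y yx.
  by have [z [Az yz zx]] := xA y yx; exists z; split=> //; exact: AB.
move=> /(sss_pos _ _ xi0)[xlim xA]; apply/sss_pos => //; split=> // zeta zxi S T.
move=> Sx Tx; have [y [Ay yx Sy Ty]] := xA zeta zxi S T Sx Tx.
by exists y; split=> //; exact: AB.
Qed.

Lemma sss_le zeta xi A x : zeta <= xi -> sss xi A x -> sss zeta A x.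
Proof.
move=> zxi xA; have [z0|z0] := pselect (is_zero zeta).
  by apply/sss_zero => //; exact: sss_cofinal xA.
have xi0 : ~ is_zero xi.
  have /not_is_zeroP[b bz] := z0.
  by apply/not_is_zeroP; exists b; exact: lt_le_trans bz zxi.
move: xA => /(sss_pos _ _ xi0)[xlim xA]; apply/sss_pos => //; split=> // eta ez.
by apply: xA; exact: lt_le_trans ez zxi.
Qed.

(** Two reflections compose: first to a point where [A] is stationary, then from there into [A]. *)
Lemma sss_sss xi A x : sss xi (sss xi A) x -> sss xi A x.
Proof.
have [xi0|xi0] := pselect (is_zero xi).
  move=> /(sss_zero _ _ xi0)[x0 xA]; apply/sss_zero => //; split=> // u ux.
  have [z [/(sss_zero _ _ xi0)[_ zA] uz zx]] := xA u ux.
  have [w [Aw uw wz]] := zA u uz.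
  by exists w; split=> //; exact: prec_trans wz zx.
move=> /(sss_pos _ _ xi0)[xlim xA]; apply/sss_pos => //; split=> // zeta zxi S T.
move=> Sx Tx; have [y [/(sss_pos _ _ xi0)[_ yA] yx Sy Ty]] := xA zeta zxi S T Sx Tx.
have [w [Aw wy Sw Tw]] := yA zeta zxi S T Sy Ty.
by exists w; split=> //; exact: prec_trans wy yx.
Qed.

Lemma sss_setIPkx xi A x : sss xi A x -> sss xi (A `&` Pkx x) x.
Proof. by apply: sss_sub => y yx; split. Qed.

(** This handles the intervals (u, x]. By induction the test set [S] may be cut down to the cone
    above [u], and a point to which the smaller set reflects lies above [u] itself. *)
Lemma sss_setI_prec xi A x u : prec u x -> sss xi A x ->
  sss xi (A `&` [set z | prec u z]) x.
Proof.
move=> ux; elim/(well_founded_ind (@lt_wf d O)): xi A => xi IH A xA.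
have xlim := sss_limit xA; have [xi0|xi0] := pselect (is_zero xi).
  apply/sss_zero => //; split; first exact: limit_Pkx0.
  move=> v vx; have [w [uw vw wx]] := prec_directed xlim ux vx.
  have [z [Az wz zx]] := (sss_cofinal xA).2 w wx.
  by exists z; split=> //; [split=> //; exact: prec_trans uw wz
                           |exact: prec_trans vw wz].
move: xA => /(sss_pos _ _ xi0)[_ xA]; apply/sss_pos => //; split=> // zeta zxi S T.
move=> /(IH _ zxi) Sx Tx; have [y [Ay yx Sy Ty]] := xA zeta zxi _ _ Sx Tx.
exists y; split=> //; last by apply: sss_sub Sy => ? ? [].
split=> //; have [[w wy] yS] := sss_cofinal Sy.
by have [z [[_ uz] _ zy]] := yS w wy; exact: prec_trans uz zy.
Qed.

Lemma sss_setIl xi A B x : sss xi (A `&` B) x -> sss xi A x.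
Proof. by apply: sss_sub => ? ? []. Qed.

(** Applied at a reflection point, this recovers the stationarity of a lower-level set that was
    absorbed into a higher-level one. *)
Lemma sss_sss_le zeta xi A B x : zeta <= xi ->
  sss xi (A `&` sss zeta B) x -> sss zeta B x.
Proof.
by move=> zxi /(sss_le zxi) ABx; apply: sss_sss; apply: sss_sub ABx => ? ? [].
Qed.

Lemma sss_setI_sss xi zeta A B x : zeta < xi -> sss xi A x -> sss zeta B x ->
  sss xi (A `&` sss zeta B) x.
Proof.
elim/(well_founded_ind (@lt_wf d O)): xi zeta A B x => xi IH zeta A B x zxi xA xB.
have xi0 : ~ is_zero xi by apply/not_is_zeroP; exists zeta.
have [xlim xA'] := (sss_pos _ _ xi0).1 xA.
apply/sss_pos => //; split=> // eta exi S T xS xT.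
have [ze|ez|eqze] := ltgtP zeta eta.
- have [y [Ay yx ySB yT]] := xA' _ exi _ _ (IH _ exi _ _ _ _ ze xS xB) xT.
  exists y; split=> //; last exact: sss_setIl ySB.
  by split=> //; exact: sss_sss_le (ltW ze) ySB.
- have xBST := IH _ zxi _ _ _ _ ez (IH _ zxi _ _ _ _ ez xB xS) xT.
  have [y [Ay yx yBST _]] := xA' _ zxi _ _ xBST xBST.
  have yBS := sss_setIl yBST.
  exists y; split=> //; first by split=> //; exact: sss_setIl yBS.
    exact: sss_sss_le (ltW ez) yBS.
  exact: sss_sss_le (ltW ez) yBST.
- subst eta; suff xST : sss zeta (sss zeta S `&` sss zeta T) x.
    have [y [Ay yx yST yB]] := xA' _ zxi _ _ xST xB.
    exists y; split=> //; apply: sss_sss; first exact: sss_setIl yST.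
    by apply: sss_sub yST => ? ? [].
  (* It remains to see that the common reflection points of [S] and [T] form a stationary set. At
     level zero this is cofinality: cutting [S] down to the cone above [u] forces the reflection
     point above [u]. *)
  have [z0|z0] := pselect (is_zero zeta).
    apply/sss_zero => //; split; first exact: limit_Pkx0.
    move=> u ux.
    have [y [_ yx ySu yT]] := xA' _ zxi _ _ (sss_setI_prec ux xS) xT.
    exists y; split=> //; first by split=> //; exact: sss_setIl ySu.
    have [[w wy] yS] := sss_cofinal ySu.
    by have [z [[_ uz] _ zy]] := yS w wy; exact: prec_trans uz zy.
  (* [S] absorbs the test sets [S'] and [T'] of lower level, so one reflection of the resulting set
     together with [T] serves all four sets. *)
  apply/sss_pos => //; split=> // theta tz S' T' xS' xT'.
  have xSS'T' := IH _ zxi _ _ _ _ tz (IH _ zxi _ _ _ _ tz xS xS') xT'.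
  have [y [_ yx ySS'T' yT]] := xA' _ zxi _ _ xSS'T' xT.
  have ySS' := sss_setIl ySS'T'.
  exists y; split=> //; first by split=> //; exact: sss_setIl ySS'.
    exact: sss_sss_le (ltW tz) ySS'.
  exact: sss_sss_le (ltW tz) ySS'T'.
Qed.

End Sss.

(** * Derived topologies *)

Section Derived.
Context {d : Order.disp_t} {O : wellOrderType d} {k : O} {X : set O}.
Implicit Types (x y z u v : PkX k X) (A B S T : set (PkX k X)).
Implicit Types xi zeta : O.

(** Removes the zero, successor and limit cases once and for all: later arguments inspect only three
    kinds of subbasic sets. *)
Lemma baseP xi (U : set (PkX k X)) : base xi U <->
  base0 U \/ exists zeta A, zeta < xi /\ U = derived zeta A.
Proof.
elim/(well_founded_ind (@lt_wf d O)): xi U => xi IH U; rewrite baseE.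
have [xi0|xi0] := pselect (is_zero xi).
  have Nlt zeta : zeta < xi -> False.
    by move=> zxi; move: (xi0 zeta); rewrite leNgt zxi.
  split=> [[[_ U0]|[zeta [/Nlt]]//|[[]]//]|[U0|[zeta [A [/Nlt]]]//]]; first by left.
  exact: Or31.
have [[zeta zs]|nsucc] := pselect (exists zeta, is_succ zeta xi).
  have zxi := zs.1; split.
    case=> [[]//|[eta [ex [es UE]]]|[[_]]]; last by case; exists zeta.
    have {es} : eta = zeta.
      apply/eqP; rewrite eq_le -(lt_succE zs) ex.
      by rewrite -(lt_succE es) zxi.
    move=> e; subst eta; case: UE => [/(IH _ zxi)[|[eta [A [ez ->]]]]|[A ->]].
    - by left.
    - by right; exists eta, A; split=> //; exact: lt_trans ez zxi.
    - by right; exists zeta, A.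
  move=> UE; apply: Or32; exists zeta, zxi; split=> //.
  case: UE => [U0|[eta [A [+ ->]]]]; first by left; apply/IH => //; left.
  rewrite (lt_succE zs) le_eqVlt => /orP[/eqP ->|ez]; first by right; exists A.
  by left; apply/IH => //; right; exists eta, A.
split.
  case=> [[]//|[zeta [_ [zs _]]]|[_ [zeta [zxi /(IH _ zxi)[|[eta [A [ez ->]]]]]]]].
  - by case: nsucc; exists zeta.
  - by left.
  - by right; exists eta, A; split=> //; exact: lt_trans ez zxi.
move=> UE; apply: Or33; split=> //.
case: UE => [U0|[zeta [A [zxi ->]]]].
  have /not_is_zeroP[zeta zxi] := xi0.
  by exists zeta, zxi; apply/IH => //; left.
(* A set derived at level [zeta] belongs to the base of any [eta] strictly between [zeta] and [xi].
   Without such an [eta], [xi] would be the successor of [zeta]. *)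
apply: contrapT => nU; apply: nsucc; exists zeta; split=> // eta ze.
rewrite leNgt; apply/negP => exi; apply: nU; exists eta, exi.
by apply/IH => //; right; exists zeta, A.
Qed.

Lemma nbhs_prec_itv xi x u :
  prec u x -> @nbhs _ (generated (base xi)) x (prec_itv u x).
Proof.
move=> ux; apply/nbhs_generated; exists (prec_itv u x); split=> //; last by right.
by apply: (@finI_from1 _ _ _ id); apply/baseP; left; right; exists u, x.
Qed.

Lemma nbhs_derived zeta xi A x : zeta < xi -> derived zeta A x ->
  @nbhs _ (generated (base xi)) x (derived zeta A).
Proof.
move=> zxi xA; apply/nbhs_generated; exists (derived zeta A); split=> //.
by apply: (@finI_from1 _ _ _ id); apply/baseP; right; exists zeta, A.
Qed.

(** Encoded as a set system so that finite intersections, of subbasic sets in (1) and of derived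
    sets in (3), follow from general filter lemmas. *)
Definition sss_preserving xi x : set_system (PkX k X) :=
  [set U | forall A, sss xi A x -> sss xi (A `&` U) x].

Lemma sss_preserving_filter xi x : Filter (sss_preserving xi x).
Proof.
split=> [A|U V HU HV A /HU/HV|U V UV HU A /HU]; first by rewrite setIT.
- by rewrite setIA.
- by apply: sss_sub => y _ [Ay /UV].
Qed.

(** A ≺-minimal point is isolated, its singleton being in [base0]. *)
Lemma derived_Pkx0 xi A x : derived xi A x -> Pkx x !=set0.
Proof.
move=> xA; apply/set0P/eqP => x0; have [|y [/eqP yx _ /yx]//] := xA [set x].
apply/nbhs_generated; exists [set x]; split=> //.
apply: (@finI_from1 _ _ _ id); apply/baseP; left; left; by exists x.
Qed.

Lemma derived_sss xi A : derived xi A = sss xi A.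
Proof.
elim/(well_founded_ind (@lt_wf d O)): xi A => xi IH A.
apply/seteqP; split=> x.
  move=> xA; have [u0 u0x] := derived_Pkx0 xA.
  have xcof : prec_cofinal A x.
    split; first by exists u0.
    move=> u ux.
    have [y [/eqP yx Ay [[uy yx']|/yx//]]] := xA _ (nbhs_prec_itv xi ux).
    by exists y.
  have [xi0|xi0] := pselect (is_zero xi); first exact/sss_zero.
  apply/sss_pos => //; split; first exact: prec_cofinal_limit xcof.
  move=> zeta zxi S T; rewrite -!IH// => xS xT.
  (* The interval factor places the limit-point witness, known only to differ from [x], strictly
     below [x]. *)
  have [y [/eqP yx Ay [[[[_ yx']|/yx//] yS] yT]]] := xA _ (filterI (filterI
    (nbhs_prec_itv xi u0x) (nbhs_derived zxi xS)) (nbhs_derived zxi xT)).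
  by exists y; split; rewrite -?IH.
move=> xA U /nbhs_generated[V [[D sD <-] Vx VU]].
suff /(_ A xA) xAV : sss_preserving xi x (\bigcap_(i in [set` D]) i).
  have [[w wx] /(_ w wx)[y [[Ay Vy] _ yx]]] := sss_cofinal xAV.
  exists y; split=> //; last exact: VU.
  by apply/eqP => e; rewrite e in yx; exact: prec_irr yx.
apply: filter_bigI (sss_preserving_filter xi x) _ => W WD B xB.
have Wx : W x := Vx W WD; have /set_mem/baseP := sD _ WD.
case=> [[[y y0 Wy]|[u [y [uy Wuy]]]]|[zeta [S [zxi WS]]]].
- rewrite -Wy in Wx; rewrite Wx in xB.
  by have [[z]] := sss_cofinal xB; rewrite y0.
(* Whether x ≺ y or x = y, the interval (u, y] contains every z with u ≺ z ≺ x. *)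
- rewrite Wuy in Wx *; case: Wx => [[ux xy]|xy].
    apply: sss_sub (sss_setI_prec ux xB) => z zx [Bz uz]; split=> //; left.
    by split=> //; exact: prec_trans zx xy.
  rewrite -xy in uy *.
  by apply: sss_sub (sss_setI_prec uy xB) => z zx [Bz uz]; split=> //; left.
- rewrite WS in Wx *; rewrite IH// in Wx *; exact: sss_setI_sss.
Qed.

End Derived.

Theorem theorem3p16 (d : Order.disp_t) (O : wellOrderType d) (k : O) (X : set O)
    (k_regular : regular_uncountable k) (kX : below k `<=` X)
    (xi : O) (xi_k : xi < k) :
  [/\ (* (1) *)
      forall A : set (PkX k X), derived xi A = [set x | sss xi A x],
      (* (2) *)
      forall (x : PkX k X) (A : set (PkX k X)),
        (sss (osucc xi) A x <->
           limit_cardinal (trace x) /\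
           forall zeta, zeta <= xi -> forall S T : set (PkX k X),
             S `<=` Pkx x -> T `<=` Pkx x -> sss zeta S x -> sss zeta T x ->
             A `&` derived zeta S `&` derived zeta T `&` Pkx x !=set0)
        /\
        ((forall zeta, zeta <= xi -> forall S T : set (PkX k X),
             S `<=` Pkx x -> T `<=` Pkx x -> sss zeta S x -> sss zeta T x ->
             A `&` derived zeta S `&` derived zeta T `&` Pkx x !=set0) <->
         (forall zeta, zeta <= xi -> forall S T : set (PkX k X),
             S `<=` Pkx x -> T `<=` Pkx x -> sss zeta S x -> sss zeta T x ->
             sss zeta (A `&` derived zeta S `&` derived zeta T) x)) &
      (* (3) *)
      forall (x : PkX k X) (A : set (PkX k X)), sss xi A x ->
        forall (n : nat) (zeta : 'I_n -> O) (B : 'I_n -> set (PkX k X)),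
          (forall i, zeta i < xi) -> (forall i, sss (zeta i) (B i) x) ->
          sss xi (A `&` \bigcap_i derived (zeta i) (B i)) x].
Proof.
have xis := osuccP xi_k.
have xis0 : ~ is_zero (osucc xi) by apply/not_is_zeroP; exists xi; exact: xis.1.
split=> [A|x A|x A xA n zeta B zxi xB].
- exact: derived_sss.
- have sssP : sss (osucc xi) A x <-> limit_cardinal (trace x) /\
      forall zeta, zeta <= xi -> forall S T : set (PkX k X),
        S `<=` Pkx x -> T `<=` Pkx x -> sss zeta S x -> sss zeta T x ->
        A `&` derived zeta S `&` derived zeta T `&` Pkx x !=set0.
    rewrite sss_pos//; split=> -[xlim xA]; split=> // zeta.
      rewrite -(lt_succE xis) => zxi S T _ _ xS xT.
      have [y [Ay yx yS yT]] := xA _ zxi _ _ xS xT.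
      by exists y; rewrite !derived_sss.
    (* The condition in (2) tests only subsets of [Pkx x], so [S] and [T] are first intersected with
       it; monotonicity then returns to the original sets. *)
    rewrite (lt_succE xis) => zxi S T /sss_setIPkx xS /sss_setIPkx xT.
    have [y] := xA _ zxi _ _ (@subIsetr _ _ _) (@subIsetr _ _ _) xS xT.
    rewrite !derived_sss => -[[[Ay /sss_setIl yS] /sss_setIl yT] yx].
    by exists y.
  split=> //; split=> xA zeta zxi S T Sx Tx xS xT.
    (* Working one level up makes [zeta] strictly smaller even when it equals [xi], so the derived
       sets can be intersected with [A] before dropping back to level [zeta]. *)
    have {}xA : sss (osucc xi) A x by apply/sssP; split=> //; exact: sss_limit xS.
    rewrite !derived_sss; have zxis : zeta < osucc xi by rewrite (lt_succE xis).
    apply: (sss_le (ltW zxis)).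
    by do 2 apply: sss_setI_sss => //.
  have [[w wx] /(_ w wx)[y [ASTy _ yx]]] := sss_cofinal (xA _ zxi _ _ Sx Tx xS xT).
  by exists y.
- have AB : sss_preserving xi x [set y | forall i, derived (zeta i) (B i) y].
    apply: filter_forall (sss_preserving_filter xi x) _ => i C xC.
    by rewrite derived_sss; exact: sss_setI_sss.
  by apply: sss_sub (AB A xA) => y _ [Ay By]; split=> // i _; exact: By.
Qed.
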